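(* Let $L:\mathbb{R}^n\times\mathbb{R}^m\to[-\infty,+\infty]$ be such that $L(\cdot,\lambda)$ is convex and lower semicontinuous for every $\lambda$ and $L(x,\cdot)$ is concave and upper semicontinuous for every $x$. Let $\eta>0$ and let $z^k=(x^k,\lambda^k)$, $k\ge0$, be generated by the proximal point method (PPM) $$(x^{k+1},\lambda^{k+1})=\arg\min_x\arg\max_\lambda\Big\{L(x,\lambda)+\tfrac1{2\eta}\|x-x^k\|_2^2-\tfrac1{2\eta}\|\lambda-\lambda^k\|_2^2\Big\}.$$ Then, with the positive semidefinite matrix $P=\frac1\eta I$, for all $k\ge0$, $$P(z^k-z^{k+1})\in\mathcal{F}(z^{k+1}).$$
   Context: For $z=(x,\lambda)$, $\mathcal{F}(z)=\begin{pmatrix}\partial_xL(x,\lambda)\\-\partial_\lambda L(x,\lambda)\end{pmatrix}$, where $\partial_xL(x,\lambda)$ is the convex subdifferential of $L(\cdot,\lambda)$ at $x$ and $-\partial_\lambda L(x,\lambda)$ is the convex subdifferential of $-L(x,\cdot)$ at $\lambda$ (at points where $L$ is finite). The $\arg\min_x\arg\max_\lambda$ in the PPM update denotes a saddle point, with finite value, of the regularized function in braces (minimum in $x$, maximum in $\lambda$); the update is assumed to be well defined. *)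

(* Defs.v *)
From HB Require Import structures.
From mathcomp Require Export all_boot all_order all_algebra.
From mathcomp Require Export all_classical all_reals all_analysis.

Set Implicit Arguments.
Unset Strict Implicit.
Unset Printing Implicit Defensive.

Import Order.TTheory GRing.Theory Num.Theory.
Import numFieldNormedType.Exports.

Local Open Scope classical_set_scope.
Local Open Scope ring_scope.

Section ExtendedConvexity.
Context {R : realType} {n : nat}.
Implicit Types (f : 'cV[R]_n -> \bar R) (x y g : 'cV[R]_n).

Definition dotv x y : R := \sum_i x i 0 * y i 0.

(* The library norm on matrices is the sup norm, hence this Euclidean one. *)
Definition norm2 x : R := Num.sqrt (dotv x x).

(* Extended real-valued functions may take both values -oo and +oo, so
   convexity is convexity of the epigraph, a subset of R^n x R; this avoids
   any convention on (+oo) + (-oo). *)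
Definition epigraph f : set (convex_lmodType ('cV[R]_n * R^o)%type) :=
  [set p | (f p.1 <= (p.2 : R)%:E)%E].

Definition econvex f : Prop := convex_set (epigraph f).

Definition econcave f : Prop := econvex (fun x => - f x)%E.

Definition upper_semicontinuous f : Prop :=
  lower_semicontinuous (fun x => - f x)%E.

(* Empty at the points where f is infinite. *)
Definition subdifferential f x : set 'cV[R]_n :=
  [set g | f x \is a fin_num /\
           forall y, (f x + (dotv g (y - x))%:E <= f y)%E].

Definition psdmx (A : 'M[R]_n) : Prop :=
  A^T = A /\ forall v : 'cV[R]_n, 0 <= dotv v (A *m v).

End ExtendedConvexity.

Section ProximalPoint.
Context {R : realType} {n m : nat}.
Implicit Types (L Phi : 'cV[R]_n -> 'cV[R]_m -> \bar R) (z : 'cV[R]_(n + m)).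

Definition saddle_point Phi (x : 'cV[R]_n) (l : 'cV[R]_m) : Prop :=
  [/\ Phi x l \is a fin_num,
      forall x', (Phi x l <= Phi x' l)%E &
      forall l', (Phi x l' <= Phi x l)%E].

(* A pair z = (x, lambda) is encoded as the stacked column vector, with
   x = usubmx z and lambda = dsubmx z. *)
Definition KKT_operator L z : set 'cV[R]_(n + m) :=
  [set g | usubmx g \in subdifferential (L ^~ (dsubmx z)) (usubmx z) /\
           dsubmx g \in subdifferential (fun l => - L (usubmx z) l)%E
                          (dsubmx z)].

Definition ppm_objective L (eta : R) z (x : 'cV[R]_n) (l : 'cV[R]_m) : \bar R :=
  (L x l + (1 / (2 * eta) * norm2 (x - usubmx z) ^+ 2)%:E
         - (1 / (2 * eta) * norm2 (l - dsubmx z) ^+ 2)%:E)%E.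

Definition ppm_step L (eta : R) z z' : Prop :=
  saddle_point (ppm_objective L eta z) (usubmx z') (dsubmx z').

End ProximalPoint.

(* Main.v *)
Require Import Defs.
From mathcomp Require Import all_boot all_order all_algebra.
From mathcomp Require Import all_classical all_reals all_analysis.
From mathcomp Require Import ring lra.
Import Order.TTheory GRing.Theory Num.Theory.
Import numFieldNormedType.Exports.
Local Open Scope classical_set_scope.
Local Open Scope ring_scope.

(** A saddle point of the regularized function is a minimum in x of
    L(., lambda') plus a quadratic, and a minimum in lambda of - L(x', .) plus
    a quadratic, where (x', lambda') is the new iterate.  So both components of
    the inclusion are instances of one fact ([prox_subdifferential]): if a
    convex function f plus (1/(2 eta)) ||. - a||^2 has a minimum x with f(x)
    finite, then (1/eta) (a - x) is a subgradient of f at x.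

    That fact is proved directly, without a sum rule for subdifferentials.
    Minimality at x is compared with the point x + t (y - x) of the segment
    towards an arbitrary y; convexity bounds the change of f by
    t (f(y) - f(x)), and expanding the square leaves, after division by t,
      f(x) + <(1/eta)(a - x), y - x> - f(y) <= t * (1/(2 eta)) ||y - x||^2
    for all t in ]0, 1].  Letting t tend to 0 gives the subgradient inequality.

    For the components to separate, the quadratic term in the fixed variable
    has to be cancelled from the saddle inequalities; this is legitimate in the
    extended reals because that term is finite, and L is finite at the new
    iterate since the regularized function is. *)

Section Euclidean.
Context {R : realType} {n : nat}.
Implicit Types (x y d : 'cV[R]_n) (t : R).

Lemma dotvv_ge0 x : 0 <= dotv x x.
Proof. by apply: sumr_ge0 => i _; rewrite -expr2 sqr_ge0. Qed.

Lemma dotvZl t x y : dotv (t *: x) y = t * dotv x y.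
Proof. by rewrite /dotv mulr_sumr; apply: eq_bigr => i _; rewrite !mxE mulrA. Qed.

Lemma dotvZr t x y : dotv x (t *: y) = t * dotv x y.
Proof. by rewrite /dotv mulr_sumr; apply: eq_bigr => i _; rewrite !mxE mulrCA. Qed.

Lemma dotvNl x y : dotv (- x) y = - dotv x y.
Proof. by rewrite -scaleN1r dotvZl mulN1r. Qed.

Lemma norm2_sqr x : norm2 x ^+ 2 = dotv x x.
Proof. by rewrite sqr_sqrtr // dotvv_ge0. Qed.

Lemma norm2_sqr_line x d t :
  norm2 (x + t *: d) ^+ 2
    = norm2 x ^+ 2 + 2 * t * dotv x d + t ^+ 2 * norm2 d ^+ 2.
Proof.
rewrite !norm2_sqr /dotv !mulr_sumr -!big_split /=.
by apply: eq_bigr => i _; rewrite !mxE; ring.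
Qed.

End Euclidean.

(** This replaces the passage to the limit t -> 0. *)
Lemma le0_small_multiples {R : realFieldType} (u w : R) :
  (forall t, 0 < t -> t <= 1 -> u <= t * w) -> u <= 0.
Proof.
move=> H; rewrite leNgt; apply/negP => u_gt0.
have uw : u <= w by rewrite -[w]mul1r; exact: H.
have w_gt0 : 0 < w by exact: lt_le_trans uw.
(* At this t the hypothesis reads u <= u / 2. *)
have := H (u / (2 * w)).
have -> : u / (2 * w) * w = u / 2 by field; rewrite gt_eqF.
rewrite divr_gt0 ?mulr_gt0 // ler_pdivrMr ?mulr_gt0 // => /(_ isT).
by move=> /(_ ltac:(lra)); lra.
Qed.

Section Prox.
Context {R : realType} {n : nat}.
Implicit Types (f : 'cV[R]_n -> \bar R) (x y a : 'cV[R]_n).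

(** Convexity is known only through the epigraph, so Jensen's inequality takes
    real upper bounds r and s in place of f(x) and f(y), which may be infinite. *)
Lemma econvex_segment f x y (r s t : R) : econvex f ->
  (f x <= r%:E)%E -> (f y <= s%:E)%E -> 0 <= t -> t <= 1 ->
  (f (x + t *: (y - x))%R <= (r + t * (s - r))%:E)%E.
Proof.
move=> cvx fx fy t0 t1.
have := cvx (y, s) (x, r) (Itv01 t0 t1).
rewrite !in_setE => /(_ fy fx); rewrite /epigraph /=.
rewrite /unstable.onem scalerBl scale1r addrCA -scalerBr.
by have -> : t *: (s : R^o) + (1 - t) *: (r : R^o) = r + t * (s - r)
  by rewrite /GRing.scale /=; ring.
Qed.

(** The optimality condition of the proximal step.  Only points y with f(y)
    finite need the segment argument: f(y) = +oo makes the subgradient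
    inequality trivial, and f(y) = -oo contradicts minimality, the value at x
    being finite. *)
Lemma prox_subdifferential f (eta : R) a x : econvex f -> 0 < eta ->
  f x \is a fin_num ->
  (forall y, f x + (1 / (2 * eta) * norm2 (x - a) ^+ 2)%:E
             <= f y + (1 / (2 * eta) * norm2 (y - a) ^+ 2)%:E)%E ->
  subdifferential f x ((1 / eta) *: (a - x)).
Proof.
move=> cvx eta_gt0 fx_fin x_min; split => // y.
have := x_min y; case fyE : (f y) => [s||]; last 2 first.
- by move=> _; rewrite leey.
- by rewrite addNye leeNy_eq; move: fx_fin; case: (f x).
move=> _.
move: fx_fin; case fxE : (f x) => [r||] // _.
rewrite -EFinD lee_fin -subr_le0 dotvZl -[a - x]opprB dotvNl.
apply: (@le0_small_multiples _ _ (1 / (2 * eta) * norm2 (y - x) ^+ 2)).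
move=> t t_gt0 t_le1.
have fxr : (f x <= r%:E)%E by rewrite fxE.
have fys : (f y <= s%:E)%E by rewrite fyE.
have ft := econvex_segment _ _ _ _ _ _ cvx fxr fys (ltW t_gt0) t_le1.
have := le_trans (x_min _) (leeD2r _ ft).
rewrite fxE -!EFinD lee_fin [_ + _ - a]addrAC norm2_sqr_line => ineq.
rewrite -(ler_pM2l t_gt0).
have -> : 1 / eta = 2 * (1 / (2 * eta)) by field; rewrite gt_eqF.
by move: (1 / (2 * eta)) ineq => c; lra.
Qed.

End Prox.

Section OptimalityStep.
Context {R : realType} {n m : nat}.

(** Subtracting the finite quadratic term in the variable that is held fixed,
    on each side of the saddle inequalities, leaves two proximal steps. *)
Lemma ppm_step_KKT (L : 'cV[R]_n -> 'cV[R]_m -> \bar R) (eta : R)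
    (z z' : 'cV[R]_(n + m)) :
  (forall l, econvex (L ^~ l)) -> (forall x, econcave (L x)) -> 0 < eta ->
  ppm_step L eta z z' -> KKT_operator L z' ((1 / eta) *: (z - z')).
Proof.
move=> cvx ccv eta_gt0 [].
rewrite /ppm_objective => Phi_fin x_min l_max.
have L_fin : L (usubmx z') (dsubmx z') \is a fin_num.
  by move: Phi_fin; case: (L _ _).
split; rewrite linearZ linearB /=; apply/mem_set; apply: prox_subdifferential => //.
- move=> y; have := x_min y.
  by rewrite leeD2rE.
- exact: ccv.
- by rewrite fin_numN.
- move=> l; have := l_max l.
  move: L_fin; case: (L _ (dsubmx z')) => [r||] // _.
  case: (L _ l) => [s||] //=; rewrite ?leey //.
  by rewrite -?EFinN -?EFinD !lee_fin; lra.
Qed.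

End OptimalityStep.

Theorem lemma1 (R : realType) (n m : nat)
    (L : 'cV[R]_n -> 'cV[R]_m -> \bar R)
    (L_convex : forall l : 'cV[R]_m, econvex (fun x => L x l))
    (L_lsc : forall l : 'cV[R]_m, lower_semicontinuous (fun x => L x l))
    (L_concave : forall x : 'cV[R]_n, econcave (fun l => L x l))
    (L_usc : forall x : 'cV[R]_n, upper_semicontinuous (fun l => L x l))
    (eta : R) (eta_gt0 : 0 < eta)
    (z : nat -> 'cV[R]_(n + m))
    (z_ppm : forall k : nat, ppm_step L eta (z k) (z k.+1)) :
  let P : 'M[R]_(n + m) := (1 / eta) *: 1%:M in
  psdmx P /\
  forall k : nat, P *m (z k - z k.+1) \in KKT_operator L (z k.+1).
Proof.
move=> P; split; first split.
- by rewrite /P linearZ /= trmx1.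
- move=> v; rewrite /P -scalemxAl mul1mx dotvZr.
  by rewrite mulr_ge0 ?dotvv_ge0 // divr_ge0 // ltW.
- move=> k; rewrite in_setE /P -scalemxAl mul1mx.
  exact: ppm_step_KKT.
Qed.
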